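(* For every $x\in[0,1]$, \[ \inf_{A}\|S_1(\mathbbm{1}_A)\|_1=B_{1,1}(x), \] where the infimum is taken over all Borel sets $A\subset[0,1)$ of Lebesgue measure $x$.
   Context: Work on $[0,1)$ with its Borel $\sigma$-algebra and Lebesgue measure. For $n\ge 0$ let $\mathcal{D}_n=\{[k/2^n,(k+1)/2^n): k=0,\dots,2^n-1\}$ and let $\mathcal{F}_n$ be the $\sigma$-algebra generated by $\mathcal{D}_n$. For $f\in L^1([0,1))$ put $f_n=\mathbb{E}(f\mid\mathcal{F}_n)$, $d_n=f_n-f_{n-1}$ for $n\ge1$, and $S_1(f)=\sum_{n\ge1}|d_n|\in[0,\infty]$. $\|g\|_1=\int_0^1|g|$. $B_{1,1}$ is the pointwise maximal function (it exists) in the family $\mathcal{F}_{1,1}$ of all non-negative continuous functions $f$ on $[0,1]$ with $f(0)=f(1)=0$ and \[ f\Big(\frac{x+y}{2}\Big)\le\frac{f(x)+f(y)}{2}+\Big|\frac{x-y}{2}\Big|\qquad\text{for all }x,y\in[0,1]; \] that is, $B_{1,1}(t)=\sup\{f(t): f\in\mathcal{F}_{1,1}\}$. *)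

(* Defs.v *)
From mathcomp Require Import all_boot all_order all_algebra.
From mathcomp Require Import all_classical all_reals all_analysis.

Set Implicit Arguments.
Unset Strict Implicit.
Unset Printing Implicit Defensive.
Import Order.TTheory GRing.Theory Num.Theory.
Import numFieldNormedType.Exports.
Local Open Scope classical_set_scope.
Local Open Scope ring_scope.

Local Notation mu := lebesgue_measure.

(* The probability space [0, 1) is handled as a subset of R: functions are
   defined on all of R, but only their restrictions to [0, 1) matter. *)
Definition unitI {R : realType} : set R := `[0, 1[.

Definition dyadic {R : realType} (n : nat) : set (set R) :=
  [set `[k%:R / 2 ^+ n, k.+1%:R / 2 ^+ n[%classic | k in `I_(2 ^ n)].

Definition dyadic_sigma {R : realType} (n : nat) : set (set R) :=
  <<s unitI, dyadic n >>.

Definition is_cond_exp {R : realType} (G : set (set R)) (f g : R -> R) : Prop :=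
  [/\ forall B : set R, measurable B -> G (unitI `&` g @^-1` B),
      mu.-integrable unitI (EFin \o g) &
      forall A : set R, G A ->
        (\int[mu]_(x in A) (g x)%:E = \int[mu]_(x in A) (f x)%:E)%E].

(* A chosen version of E(f | G).  For G = dyadic_sigma n and f integrable on
   [0, 1), a version exists and its values on [0, 1) do not depend on the
   choice, since the atoms of G are the intervals of dyadic n, all of positive
   measure.  The default value is only used when no version exists. *)
Definition cond_exp {R : realType} (G : set (set R)) (f : R -> R) : R -> R :=
  xget (cst 0) [set g | is_cond_exp G f g].

Definition mart {R : realType} (f : R -> R) (n : nat) : R -> R :=
  cond_exp (dyadic_sigma n) f.

Definition S1 {R : realType} (f : R -> R) (x : R) : \bar R :=
  (\sum_(1 <= n <oo) `|mart f n x - mart f n.-1 x|%:E)%E.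

Definition norm1 {R : realType} (g : R -> \bar R) : \bar R :=
  (\int[mu]_(x in unitI) `|g x|)%E.

Definition F11 {R : realType} : set (R -> R) :=
  [set f : R -> R |
            [/\ {within `[0, 1], continuous f},
               forall x : R, x \in `[0, 1] -> 0 <= f x,
               f 0 = 0, f 1 = 0 &
               forall x y : R, x \in `[0, 1] -> y \in `[0, 1] ->
                 f ((x + y) / 2) <= (f x + f y) / 2 + `|(x - y) / 2|]].

Definition B11 {R : realType} (t : R) : \bar R :=
  ereal_sup [set (f t)%:E | f in F11].

(* Main.v *)
(* On a dyadic interval of generation [n-1] the martingale of an indicator takes
   two values [a], [b] on the halves, with mean its previous value, and [|d_n|] is
   [|a - b| / 2]. Hence for [f] in [F11] the quantity E f(f_n) + E sum_(i <= n) |d_i|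
   is nondecreasing in [n]; as f_n tends to an indicator and f vanishes at 0 and 1,
   f(|A|) <= ||S_1(1_A)||_1.
   Conversely, let W(x) be the infimum over sets of measure x. Placing rescaled
   copies of A and B in the two halves of [0, 1) shows that W satisfies the midpoint
   inequality; W vanishes at 0 and 1 and is at most 1 (initial intervals). A bounded
   function with these properties is automatically continuous, so W belongs to [F11]
   and is bounded by B_(1,1). *)
Require Import Defs.
From mathcomp Require Import all_boot all_order all_algebra ring lra zify.
From mathcomp Require Import all_classical all_reals all_analysis measurable_realfun.
Import Order.TTheory GRing.Theory Num.Theory.
Import numFieldNormedType.Exports.
Local Open Scope classical_set_scope.
Local Open Scope ring_scope.

Set Implicit Arguments.
Unset Strict Implicit.
Unset Printing Implicit Defensive.

(** * Dyadic intervals: location of points, halving, measure *)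

Definition dyint {R : realType} (n k : nat) : set R :=
  `[k%:R / 2 ^+ n, k.+1%:R / 2 ^+ n[%classic.

Lemma dyintP {R : realType} n k (y : R) :
  dyint n k y <-> k%:R <= 2 ^+ n * y < k.+1%:R.
Proof.
rewrite /dyint /= in_itv /= ler_pdivrMr ?exprn_gt0// ltr_pdivlMr ?exprn_gt0//.
by rewrite mulrC.
Qed.

Lemma dyint_inj {R : realType} n k j (y : R) :
  dyint n k y -> dyint n j y -> k = j.
Proof.
move=> /dyintP/andP[k1 k2] /dyintP/andP[j1 j2].
have := le_lt_trans k1 j2; have := le_lt_trans j1 k2.
by rewrite !ltr_nat; lia.
Qed.

Lemma dyint_sub_unitI {R : realType} n k : (k < 2 ^ n)%N ->
  dyint n k `<=` @unitI R.
Proof.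
move=> kn y /dyintP/andP[h1 h2]; rewrite /unitI /= in_itv /=.
have p : 0 < 2 ^+ n :> R by rewrite exprn_gt0.
apply/andP; split.
  by rewrite -(pmulr_rge0 _ p); apply: le_trans h1.
rewrite -(ltr_pM2l p) mulr1; apply: lt_le_trans h2 _.
by rewrite -natrX ler_nat.
Qed.

Lemma unitI_dyint {R : realType} n (y : R) : unitI y ->
  exists2 k, (k < 2 ^ n)%N & dyint n k y.
Proof.
rewrite /unitI /= in_itv /= => /andP[y0 y1].
have p : 0 < 2 ^+ n :> R by rewrite exprn_gt0.
have /truncn_itv h : 0 <= 2 ^+ n * y by rewrite mulr_ge0// ltW.
exists (Num.trunc (2 ^+ n * y)); last exact/dyintP.
rewrite -(ltr_nat R) natrX; have /andP[h1 _] := h.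
by apply: le_lt_trans h1 _; rewrite -[ltRHS]mulr1 ltr_pM2l.
Qed.

Lemma dyint_half {R : realType} n k : @dyint R n.+1 k `<=` dyint n k./2.
Proof.
move=> y /dyintP/andP[h1 h2]; apply/dyintP.
have e : 2 ^+ n.+1 * y = 2 * (2 ^+ n * y) by rewrite exprS mulrA.
move: h1 h2; rewrite e -[in k%:R](odd_double_half k) -[in k.+1](odd_double_half k) => h1 h2.
apply/andP; split.
  rewrite -(ler_pM2l (@ltr0Sn R 1)); apply: le_trans h1.
  by rewrite -natrM ler_nat; lia.
rewrite -(ltr_pM2l (@ltr0Sn R 1)); apply: lt_le_trans h2 _.
by rewrite -natrM ler_nat; case: (odd k); lia.
Qed.

Lemma dyint_split {R : realType} n k :
  @dyint R n k = dyint n.+1 k.*2 `|` dyint n.+1 k.*2.+1.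
Proof.
apply/seteqP; split => [y /dyintP/andP[h1 h2]|y [] /dyint_half]; last 2 first.
  by rewrite doubleK.
  by rewrite -add1n halfD doubleK odd_double add0n.
have e : 2 ^+ n.+1 * y = 2 * (2 ^+ n * y) by rewrite exprS mulrA.
have d1 : k.*2%:R = 2 * k%:R :> R by rewrite -mul2n natrM.
have [hy|hy] := ltP (2 ^+ n.+1 * y) k.*2.+1%:R; [left|right]; apply/dyintP; rewrite hy.
  by rewrite andbT e d1 ler_pM2l.
by rewrite /= e (_ : k.*2.+2%:R = 2 * k.+1%:R) ?ltr_pM2l// -natrM; congr (_%:R); lia.
Qed.

Lemma dyint0 {R : realType} : @dyint R 0 0 = unitI.
Proof. by rewrite /dyint /unitI expr0 divr1 divr1. Qed.

Lemma measurable_dyint {R : realType} n k : measurable (@dyint R n k).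
Proof. exact: measurable_itv. Qed.

Lemma measurable_unitI {R : realType} : measurable (@unitI R).
Proof. exact: measurable_itv. Qed.

#[global] Hint Extern 0 (measurable _) =>
  solve [exact: measurable_dyint | exact: measurable_unitI] : core.

Lemma lebesgue_measure_dyint {R : realType} n k :
  lebesgue_measure (@dyint R n k) = ((2 ^+ n)^-1)%:E.
Proof.
rewrite lebesgue_measure_itv /= lte_fin ltr_pM2r ?invr_gt0 ?exprn_gt0//.
rewrite ltr_nat leqnn -EFinD; congr EFin.
by rewrite -mulrBl -natrB// subSnn mul1r.
Qed.

Lemma trivIset_dyint {R : realType} n (D : set nat) : trivIset D (@dyint R n).
Proof. by move=> i j _ _ [y [hi hj]]; exact: dyint_inj hi hj. Qed.

Lemma dyadicP {R : realType} n k : (k < 2 ^ n)%N -> @dyadic R n (dyint n k).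
Proof. by move=> kn; exists k. Qed.

(** * The sigma-algebra of a dyadic generation *)

Lemma dyadic_sigma_dyint {R : realType} n k : (k < 2 ^ n)%N ->
  @dyadic_sigma R n (dyint n k).
Proof. by move=> kn; apply: sub_gen_smallest; exact: dyadicP. Qed.

Lemma dyadic_sigma_bigcup {R : realType} n (K : set nat) :
  K `<=` `I_(2 ^ n) -> @dyadic_sigma R n (\bigcup_(k in K) dyint n k).
Proof.
move=> Kn; rewrite bigcup_mkcond; apply: sigma_algebra_bigcup => k.
case: ifPn => [/set_mem/Kn kn|_]; first exact: dyadic_sigma_dyint.
by have [] := smallest_sigma_algebra (@unitI R) (dyadic n).
Qed.

(** The subsets of [unitI] that contain or miss each interval of generation [n] form a sigma-algebra
    [C] containing [dyadic n]; a member of [C] is the union of the intervals it contains. *)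
Lemma dyadic_sigmaP {R : realType} n (A : set R) : dyadic_sigma n A ->
  exists2 K : set nat, K `<=` `I_(2 ^ n) & A = \bigcup_(k in K) dyint n k.
Proof.
pose C := [set A : set R | A `<=` unitI /\
  forall k, (k < 2 ^ n)%N -> dyint n k `<=` A \/ dyint n k `&` A = set0].
suff AC : dyadic_sigma n `<=` C.
  move=> /AC[AI hA]; exists [set k | (k < 2 ^ n)%N /\ dyint n k `<=` A].
    by move=> k [].
  apply/seteqP; split => [y Ay|y [k [kn kA]]]; last exact: kA.
  have [k kn ky] := unitI_dyint n (AI _ Ay); exists k => //; split => //.
  by case: (hA k kn) => // h0; have : set0 y by rewrite -h0.
apply: smallest_sub; last first.
  move=> _ [k kn <-]; split; first exact: dyint_sub_unitI.
  move=> j jn; have [->|kj] := eqVneq k j; [by left|right].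
  apply/seteqP; split=> // y [yj yk]; move/eqP: kj; case; exact: dyint_inj yk yj.
split.
- by split => // k kn; right; rewrite setI0.
- move=> B [BI hB]; split; first exact: subDsetl.
  move=> k kn; have [h|h] := hB k kn.
    by right; apply/seteqP; split=> // y [/h By []].
  left=> y ky; split; first exact: dyint_sub_unitI ky.
  by move=> By; have : set0 y by rewrite -h.
- move=> B hB; split; first by apply: bigcup_sub => i _; exact: (hB i).1.
  move=> k kn; have [[i hi]|hi] := pselect (exists i, dyint n k `<=` B i).
    by left; apply: subset_trans hi _; exact: bigcup_sup.
  right; rewrite setI_bigcupr bigcup0// => i _.
  by have [h|//] := (hB i).2 k kn; case: hi; exists i.
Qed.

(** * Step functions and conditional expectations of indicators *)

Definition step {R : realType} (n : nat) (c : nat -> R) (y : R) : R :=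
  \sum_(k < 2 ^ n) c k * \1_(dyint n k) y.

Lemma step_val {R : realType} n (c : nat -> R) k y : (k < 2 ^ n)%N ->
  dyint n k y -> step n c y = c k.
Proof.
move=> kn ky; rewrite /step (bigD1 (Ordinal kn)) //= indicE mem_set// mulr1.
rewrite big1 ?addr0// => j jk; rewrite indicE memNset ?mulr0// => jy.
by move/eqP: jk; apply; apply/val_inj => /=; exact: dyint_inj jy ky.
Qed.

Lemma measurable_step {R : realType} n (c : nat -> R) (D : set R) :
  measurable_fun D (step n c).
Proof.
apply: measurable_sum => k; apply: measurable_funM => //.
Qed.

Lemma step_ge0 {R : realType} n (c : nat -> R) y : (forall k, 0 <= c k) ->
  0 <= step n c y.
Proof. by move=> c0; apply: sumr_ge0 => k _; rewrite mulr_ge0. Qed.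

Lemma integral_dyint_cst {R : realType} n k (g : R -> R) r :
  (forall y, dyint n k y -> g y = r) ->
  (\int[lebesgue_measure]_(y in dyint n k) (g y)%:E)%E = (r / 2 ^+ n)%:E.
Proof.
move=> gr; under eq_integral => y /set_mem/gr -> do [].
by rewrite [LHS]integral_cst//= lebesgue_measure_dyint.
Qed.

Lemma unitI_bigcup {R : realType} n :
  @unitI R = \bigcup_(k in `I_(2 ^ n)) dyint n k.
Proof.
apply/seteqP; split => [y /(unitI_dyint n)[k kn ky]|]; first by exists k.
by apply: bigcup_sub => k; exact: dyint_sub_unitI.
Qed.

Lemma integral_dyadic {R : realType} n (K : set nat) (f : R -> \bar R) :
  measurable_fun setT f -> (forall y, 0 <= f y)%E ->
  (\int[lebesgue_measure]_(y in \bigcup_(k in K) dyint n k) f y =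
   \sum_(k <oo | k \in K) \int[lebesgue_measure]_(y in dyint n k) f y)%E.
Proof.
move=> mf f0; rewrite bigcup_mkcond ge0_integral_bigcup//.
- rewrite [RHS]eseries_mkcond; apply: eq_eseriesr => k _.
  by case: ifP => // _; rewrite integral_set0.
- by move=> k; case: ifP.
- exact: measurable_funTS.
- rewrite -trivIset_mkcond; exact: trivIset_dyint.
Qed.

Lemma integral_step {R : realType} n (c : nat -> R) : (forall k, 0 <= c k) ->
  (\int[lebesgue_measure]_(y in unitI) (step n c y)%:E)%E =
  ((\sum_(k < 2 ^ n) c k) / 2 ^+ n)%:E.
Proof.
move=> c0; rewrite (unitI_bigcup n) integral_dyadic//; first last.
- by move=> y; rewrite lee_fin step_ge0.
- by apply/measurable_EFinP; exact: measurable_step.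
rewrite (nneseries_split_cond 0 (2 ^ n)); last first.
  by move=> k _; apply: integral_ge0 => y _; rewrite lee_fin step_ge0.
rewrite eseries0 ?adde0; last by move=> k /= + /set_mem /=; rewrite add0n leqNgt => /negP.
rewrite add0n big_mkcond big_mkord mulr_suml -sumEFin; apply: eq_bigr => k _.
rewrite mem_set /=; last exact: ltn_ord.
by apply: integral_dyint_cst => y; exact: step_val.
Qed.

(* The value on [dyint n k] of the conditional expectation of the indicator of [A]. *)
Definition dens {R : realType} (A : set R) (n k : nat) : R :=
  2 ^+ n * fine (lebesgue_measure (A `&` dyint n k)).

Lemma lebesgue_measure_setI_dyint {R : realType} (A : set R) n k :
  measurable A -> lebesgue_measure (A `&` dyint n k) = (dens A n k / 2 ^+ n)%:E.
Proof.
move=> mA; rewrite /dens mulrC mulKf ?expf_neq0// fineK//.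
rewrite ge0_fin_numE//; apply: le_lt_trans (ltry ((2 ^+ n)^-1)).
rewrite -(lebesgue_measure_dyint n k); apply: le_measure; rewrite ?inE//.
exact: measurableI.
Qed.

Lemma dens_ge0 {R : realType} (A : set R) n k : 0 <= dens A n k.
Proof. by rewrite mulr_ge0// fine_ge0. Qed.

Lemma dens_le1 {R : realType} (A : set R) n k : measurable A -> dens A n k <= 1.
Proof.
move=> mA; have : (lebesgue_measure (A `&` dyint n k) <= ((2 ^+ n)^-1)%:E)%E.
  rewrite -(lebesgue_measure_dyint n k); apply: le_measure; rewrite ?inE//.
  exact: measurableI.
rewrite lebesgue_measure_setI_dyint// lee_fin ler_pdivrMr ?exprn_gt0//.
by rewrite mulVf// expf_neq0.
Qed.

Lemma is_cond_exp_step {R : realType} (A : set R) n : measurable A ->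
  is_cond_exp (dyadic_sigma n) (\1_A : R -> R) (step n (dens A n)).
Proof.
move=> mA; split.
- move=> B mB.
  rewrite (_ : _ `&` _ = \bigcup_(k in [set k | (k < 2 ^ n)%N /\ B (dens A n k)]) dyint n k).
    by apply: dyadic_sigma_bigcup => k [].
  apply/seteqP; split=> y.
    by move=> [/(unitI_dyint n)[k kn ky]] /=; rewrite (step_val _ kn ky) => Bk; exists k.
  move=> [k [kn Bk] ky]; split; first exact: dyint_sub_unitI ky.
  by rewrite /= (step_val _ kn ky).
- apply/integrableP; split; first by apply/measurable_EFinP; exact: measurable_step.
  under eq_integral => y _.
    rewrite /= ger0_norm; last by apply: step_ge0 => k; exact: dens_ge0.
    over.
  by rewrite integral_step ?ltry//; exact: dens_ge0.
(* Both integrals split over the disjoint intervals indexed by [K], and on each interval both equal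
   [dens A n k / 2 ^+ n]. *)
- move=> _ /dyadic_sigmaP[K Kn ->].
  rewrite !integral_dyadic//; first last.
  + by move=> y; rewrite lee_fin step_ge0//; exact: dens_ge0.
  + by apply/measurable_EFinP; exact: measurable_step.
  + by apply/measurable_EFinP; exact: measurable_indic.
  apply: eq_eseriesr => k /set_mem/Kn kn.
  rewrite integral_indic//= lebesgue_measure_setI_dyint//.
  by apply: integral_dyint_cst => y; exact: step_val.
Qed.

(** Any version is determined at every point: the level set of [g] through [y] belongs to the
    sigma-algebra, so it contains the whole interval around [y], and [g] is constant there. *)
Lemma is_cond_exp_dyint {R : realType} n k (f g : R -> R) y :
  (k < 2 ^ n)%N -> dyint n k y -> is_cond_exp (dyadic_sigma n) f g ->
  (\int[lebesgue_measure]_(z in dyint n k) (f z)%:E)%E = (g y / 2 ^+ n)%:E.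
Proof.
move=> kn ky [gG _ <-]; last exact: dyadic_sigma_dyint.
apply: integral_dyint_cst => z kz.
have [K Kn hK] := dyadic_sigmaP (gG [set g y] (measurable_set1 _)).
have : (unitI `&` g @^-1` [set g y]) y by split => //; exact: dyint_sub_unitI ky.
rewrite hK => -[j Kj /(dyint_inj ky) kj]; subst j.
have : (\bigcup_(k in K) dyint n k) z by exists k.
by rewrite -hK => -[].
Qed.

(** The step function shows that a version exists, so the default value of [xget] does not occur;
    comparing integrals over the interval then identifies the chosen version with the step
    function. *)
Lemma mart_dens {R : realType} (A : set R) n k y : measurable A ->
  (k < 2 ^ n)%N -> dyint n k y -> mart (\1_A : R -> R) n y = dens A n k.
Proof.
move=> mA kn ky; have h := is_cond_exp_step n mA.
have : is_cond_exp (dyadic_sigma n) (\1_A : R -> R) (mart (\1_A : R -> R) n).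
  by apply: xgetPex; exists (step n (dens A n)).
move=> /(is_cond_exp_dyint kn ky); rewrite (is_cond_exp_dyint kn ky h).
case=> /(mulIf _) <-; first by rewrite (step_val _ kn ky).
by rewrite invr_eq0 expf_neq0.
Qed.

(** * The norm of [S1] as a series of increments *)

(* The L^1 norm of the martingale difference [d_(n+1)]: the index is shifted by one. *)
Definition dvar {R : realType} (A : set R) (n : nat) : R :=
  (\sum_(k < 2 ^ n.+1) `|dens A n.+1 k - dens A n k./2|) / 2 ^+ n.+1.

Lemma dvar_ge0 {R : realType} (A : set R) n : 0 <= dvar A n.
Proof. by rewrite mulr_ge0// ?invr_ge0 ?exprn_ge0// sumr_ge0. Qed.

(** On [unitI] each absolute difference is a step function of generation [n.+1]; since the terms are
    nonnegative, sum and integral may be exchanged. *)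
Lemma norm1_S1 {R : realType} (A : set R) : measurable A ->
  norm1 (S1 (\1_A : R -> R)) = (\sum_(n <oo) (dvar A n)%:E)%E.
Proof.
move=> mA; pose c n k := `|dens A n.+1 k - dens A n k./2|.
have hS y : unitI y -> S1 (\1_A : R -> R) y = (\sum_(n <oo) (step n.+1 (c n) y)%:E)%E.
  (* [S1] sums from 1 while [dvar] counts from 0, hence the shift; below, [k./2] is the index of the
     parent of interval [k]. *)
  move=> Iy; rewrite /S1 -(nneseries_addn 1); last by move=> n; rewrite lee_fin.
  apply: eq_eseriesr => n _; congr (_%:E); rewrite addn1 /=.
  have [k kn ky] := unitI_dyint n.+1 Iy; rewrite (step_val _ kn ky) /c.
  rewrite (mart_dens mA kn ky) (@mart_dens _ _ n k./2)//; last exact: dyint_half.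
  by move: kn; rewrite expnS; lia.
rewrite /norm1; under eq_integral => y /set_mem Iy.
  rewrite hS// gee0_abs; last first.
    by apply: nneseries_ge0 => n _ _; rewrite lee_fin step_ge0// => k; exact: normr_ge0.
  over.
rewrite integral_nneseries//.
- by apply: eq_eseriesr => n _; rewrite integral_step// => k; exact: normr_ge0.
- by move=> n; apply/measurable_EFinP; exact: measurable_step.
- by move=> n y _; rewrite lee_fin step_ge0// => k; exact: normr_ge0.
Qed.

(** The norm may be infinite, so both inequalities of the theorem work with real partial sums and
    pass to the norm through this equivalence. *)
Lemma norm1_S1_le {R : realType} (A : set R) (r : \bar R) : measurable A ->
  (norm1 (S1 (\1_A : R -> R)) <= r)%E <->
  forall N, ((\sum_(n < N) dvar A n)%:E <= r)%E.
Proof.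
move=> mA; rewrite norm1_S1//; split => [h N|h].
  apply: le_trans h; rewrite -sumEFin -(big_mkord xpredT (fun n => (dvar A n)%:E)).
  by apply: nneseries_lim_ge => n _ _; rewrite lee_fin dvar_ge0.
apply: lime_le.
  by apply: is_cvg_nneseries => n _ _; rewrite lee_fin dvar_ge0.
by apply: nearW => N; rewrite big_mkord sumEFin.
Qed.

(** * Densities under halving *)

Lemma big_double (V : nmodType) (F : nat -> V) m :
  \sum_(k < m.*2) F k = \sum_(k < m) (F k.*2 + F k.*2.+1).
Proof.
by elim: m => [|m IH]; rewrite ?big_ord0// doubleS !big_ord_recr /= IH addrA.
Qed.

Lemma fin_num_setI_dyint {R : realType} (A : set R) n k : measurable A ->
  lebesgue_measure (A `&` dyint n k) \is a fin_num.
Proof. by move=> mA; rewrite lebesgue_measure_setI_dyint. Qed.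

Lemma dens_split {R : realType} (A : set R) n k : measurable A ->
  dens A n k = (dens A n.+1 k.*2 + dens A n.+1 k.*2.+1) / 2.
Proof.
move=> mA; have e : A `&` dyint n k =
    (A `&` dyint n.+1 k.*2) `|` (A `&` dyint n.+1 k.*2.+1).
  by rewrite dyint_split setIUr.
rewrite /dens e measureU ?fineD ?fin_num_setI_dyint//.
- by rewrite exprS; field.
- exact: measurableI.
- exact: measurableI.
- apply/seteqP; split => // y [[_ h1] [_ h2]].
  by have := dyint_inj h1 h2; lia.
Qed.

Lemma densC {R : realType} (A : set R) n k : measurable A ->
  dens (~` A) n k = 1 - dens A n k.
Proof.
move=> mA; have mC : measurable (~` A) by exact: measurableC.
have : lebesgue_measure (dyint n k) =
    (lebesgue_measure (A `&` dyint n k) + lebesgue_measure (~` A `&` dyint n k))%E.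
  rewrite -measureU; first by rewrite -setIUl setUv setTI.
  - exact: measurableI.
  - exact: measurableI.
  - by rewrite setIACA setICr set0I.
rewrite lebesgue_measure_dyint !lebesgue_measure_setI_dyint// -EFinD => -[].
rewrite -mulrDl -[LHS]mul1r => /mulIf ->; first by rewrite addrC addKr.
by rewrite invr_eq0 expf_neq0.
Qed.

Lemma dens_le {R : realType} (A B : set R) n k : measurable A -> measurable B ->
  A `&` dyint n k `<=` B -> dens A n k <= dens B n k.
Proof.
move=> mA mB AB; rewrite ler_pM2l ?exprn_gt0// fine_le ?fin_num_setI_dyint//.
apply: le_measure; rewrite ?inE; [exact: measurableI|exact: measurableI|].
by move=> y Ay; split; [exact: AB|case: Ay].
Qed.

Lemma dens00 {R : realType} (A : set R) : A `<=` unitI ->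
  dens A 0 0 = fine (lebesgue_measure A).
Proof. by move=> AI; rewrite /dens expr0 mul1r dyint0 (setIidl AI). Qed.

Lemma dens_avg {R : realType} (A : set R) n : measurable A ->
  (\sum_(k < 2 ^ n) dens A n k) / 2 ^+ n = dens A 0 0.
Proof.
move=> mA; elim: n => [|n <-]; first by rewrite expn0 big_ord1 expr0 divr1.
rewrite expnS mul2n (big_double (dens A n.+1)) exprS invfM mulrA mulr_suml; congr (_ / _).
by apply: eq_bigr => k _; rewrite -dens_split.
Qed.

(** Each of two sibling values [a], [b] is at distance [|a - b| / 2] from their mean, so the pair
    contributes [|a - b|]. *)
Lemma dvarE {R : realType} (A : set R) n : measurable A ->
  dvar A n = (\sum_(k < 2 ^ n) `|dens A n.+1 k.*2 - dens A n.+1 k.*2.+1|) / 2 ^+ n.+1.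
Proof.
move=> mA; rewrite /dvar expnS mul2n (big_double (fun k => `|dens A n.+1 k - dens A n k./2|)); congr (_ / _).
apply: eq_bigr => k _; rewrite doubleK (_ : k.*2.+1./2 = k); last by lia.
rewrite (dens_split n k mA); set a := dens _ _ _; set b := dens _ _ _.
have -> : a - (a + b) / 2 = (a - b) / 2 by field.
have -> : b - (a + b) / 2 = - ((a - b) / 2) by field.
by rewrite normrN normrM [`|2^-1|]ger0_norm//; field.
Qed.

(** * Lower bound for the norm: the martingale inequality *)

(* The two values of the martingale on the halves of a dyadic interval average to
   its value on the whole, so this is the inequality defining [F11], summed over
   intervals. *)
Lemma F11_step {R : realType} (f : R -> R) (A : set R) n : F11 f -> measurable A ->
  (\sum_(k < 2 ^ n) f (dens A n k)) / 2 ^+ n <=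
  (\sum_(k < 2 ^ n.+1) f (dens A n.+1 k)) / 2 ^+ n.+1 + dvar A n.
Proof.
move=> [_ _ _ _ hf] mA; rewrite dvarE// -mulrDl expnS mul2n (big_double (f \o dens A n.+1)) -big_split /=.
rewrite exprS invfM mulrA ler_pM2r ?invr_gt0 ?exprn_gt0// mulr_suml.
apply: ler_sum => k _; rewrite (dens_split n k mA).
set a := dens _ _ _; set b := dens _ _ _.
have h j : dens A n.+1 j \in `[0, 1] by rewrite in_itv /= dens_ge0 dens_le1.
apply: le_trans (hf a b (h _) (h _)) _.
by rewrite normrM [`|2^-1|]ger0_norm// -mulrDl.
Qed.

Lemma F11_le_dvar {R : realType} (f : R -> R) (A : set R) N : F11 f -> measurable A ->
  f (dens A 0 0) <=
  (\sum_(k < 2 ^ N) f (dens A N k)) / 2 ^+ N + \sum_(n < N) dvar A n.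
Proof.
move=> Ff mA; elim: N => [|N IH].
  by rewrite expn0 big_ord1 expr0 divr1 big_ord0 addr0.
apply: le_trans IH _; rewrite big_ord_recr /= addrA [leRHS]addrAC lerD2r.
exact: F11_step.
Qed.

(** This reduces the vanishing of the mean of [f] along the martingale to that of [min(t, 1 - t)].
    Within [d] of an endpoint continuity gives [f t <= e]; elsewhere [min(t, 1 - t)] is at least [d]
    and the maximum [f c] of [f] is absorbed by [C]. *)
Lemma F11_bound {R : realType} (f : R -> R) (e : R) : F11 f -> 0 < e ->
  exists2 C : R, 0 < C &
    forall t, t \in `[0, 1] -> f t <= e + C * Num.min t (1 - t).
Proof.
move=> [cf f0 f00 f10 _] e0.
have [c c01 fc] := EVT_max ler01 cf.
have M0 : 0 <= f c by exact: f0.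
have [_ /cvgrPdist_lt/(_ _ e0) h0 /cvgrPdist_lt/(_ _ e0) h1] :=
  (continuous_within_itvP f ltr01).1 cf.
move: h0 h1; rewrite f00 f10.
rewrite near_withinE => -[d0 /= d00 h0]; rewrite near_withinE => -[d1 /= d10 h1].
pose d := Num.min d0 d1; have d_gt0 : 0 < d by rewrite lt_min d00 d10.
(* The added 1 keeps the constant positive even when [f c = 0]. *)
have C0 : 0 < (f c + 1) / d by rewrite divr_gt0// ltr_wpDl.
exists ((f c + 1) / d) => // t; rewrite in_itv /= => /andP[t0 t1].
have m0 : 0 <= Num.min t (1 - t) by rewrite le_min t0 subr_ge0.
have [dt|td] := leP d (Num.min t (1 - t)).
  apply: (@le_trans _ _ (f c)); first by apply: fc; rewrite in_itv /= t0.
  apply: (@le_trans _ _ ((f c + 1) / d * d)); first by rewrite divfK ?gt_eqF// lerDl.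
  by rewrite -[leLHS]add0r lerD ?ler_wpM2l// ltW.
suff : f t <= e by move=> h; rewrite (le_trans h)// lerDl mulr_ge0// ltW.
move: td; rewrite gt_min => /orP[td|td].
  (* The one-sided limit says nothing at the endpoint itself, where [f] is 0 by hypothesis. *)
  have [->|tn0] := eqVneq t 0; first by rewrite f00 ltW.
  have t_gt0 : 0 < t by rewrite lt_neqAle eq_sym tn0.
  have := h0 t; rewrite /ball /= sub0r normrN ger0_norm// sub0r normrN.
  move=> /(_ _ t_gt0); rewrite (lt_le_trans td)// => [/(_ isT)/ltW|]; last by rewrite ge_min lexx.
  by apply: le_trans; exact: ler_norm.
have [->|tn1] := eqVneq t 1; first by rewrite f10 ltW.
have t_lt1 : t < 1 by rewrite lt_neqAle tn1.
have := h1 t; rewrite /ball /= ger0_norm ?subr_ge0// sub0r normrN.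
move=> /(_ _ t_lt1); rewrite (lt_le_trans td)// => [/(_ isT)/ltW|]; last by rewrite ge_min lexx orbT.
by apply: le_trans; exact: ler_norm.
Qed.

(** * Dyadic approximation of closed sets and smallness of intermediate densities *)

Definition dyadic_hull {R : realType} (n : nat) (V : set R) : set R :=
  \bigcup_(k in [set k | (k < 2 ^ n)%N /\ dyint n k `&` V !=set0]) dyint n k.

Lemma measurable_dyadic_hull {R : realType} n (V : set R) :
  measurable (dyadic_hull n V).
Proof. by apply: bigcup_measurable => k _. Qed.

Lemma dyadic_hullS {R : realType} n (V : set R) :
  dyadic_hull n.+1 V `<=` dyadic_hull n V.
Proof.
move=> y [k [kn [z [kz Vz]]] ky]; exists k./2; last exact: dyint_half.
split; first by move: kn; rewrite expnS; lia.
by exists z; split => //; exact: dyint_half.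
Qed.

Lemma dyadic_hull_unitI {R : realType} n (V : set R) : dyadic_hull n V `<=` unitI.
Proof. by apply: bigcup_sub => k [kn _]; exact: dyint_sub_unitI. Qed.

(** A point in every hull shares an interval of length [2^-n] with a point of [V] for each [n],
    hence is a limit of points of [V]. *)
Lemma bigcap_dyadic_hull {R : realType} (V : set R) : closed V ->
  \bigcap_n dyadic_hull n V `<=` V.
Proof.
move=> cV y hy; apply: contrapT => nVy.
have /nbhs_ballP[e /= e0 he] : nbhs y (~` V).
  by apply: open_nbhs_nbhs; split => //; exact: closed_openC.
have [n hn] : exists n, (2 ^+ n)^-1 < e.
  have [n _ /(_ n)/=] := near_infty_natSinv_expn_lt (PosNum e0).
  by rewrite leqnn => /(_ isT); rewrite div1r; exists n.
have [k [kn [z [kz Vz]]] ky] := hy n I.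
apply: he Vz; rewrite /ball /=; apply: lt_trans hn.
have p : 0 < 2 ^+ n :> R by rewrite exprn_gt0.
rewrite -[ltRHS]mulr1 ltr_pdivlMl// -[X in X * _](gtr0_norm p) -normrM mulrBr.
move: kz ky => /dyintP/andP[+ +] /dyintP/andP[].
by rewrite ltr_norml -[k.+1]addn1 natrD; lra.
Qed.

(** The sets [G n] decrease to the empty set and have finite measure, so continuity from above
    applies. *)
Lemma measure_dyadic_hull_small {R : realType} (V : set R) (e : R) :
  closed V -> 0 < e ->
  exists n, dens (dyadic_hull n V `\` V) 0 0 < e.
Proof.
move=> cV e0; pose G n := dyadic_hull n V `\` V.
have mG n : measurable (G n).
  by apply: measurableD; [exact: measurable_dyadic_hull|exact: closed_measurable].
have GI n : G n `<=` unitI by move=> y [/dyadic_hull_unitI].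
have G0 : \bigcap_n G n = set0.
  apply/seteqP; split => // y hy; have [_ nVy] := hy 0%N I; apply: nVy.
  by apply: bigcap_dyadic_hull => // n _; case: (hy n I).
have : (lebesgue_measure \o G) x @[x --> \oo] --> lebesgue_measure (\bigcap_n G n).
  apply: nonincreasing_cvg_mu => //.
  - apply: le_lt_trans (ltry 1); rewrite -(invr1 R) -(expr0 2).
    rewrite -(lebesgue_measure_dyint 0 0) dyint0; apply: le_measure; rewrite ?inE//; exact: mG.
  - by rewrite G0.
  - apply/nonincreasing_seqP => n; rewrite subsetEset => y [/dyadic_hullS ? ?].
    by split.
rewrite G0 measure0 => /fine_cvgP[_ /cvgrPdist_lt/(_ _ e0)[n _ /(_ n)/=]].
rewrite leqnn => /(_ isT); rewrite sub0r normrN => h; exists n.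
rewrite (dens00 (GI n)); exact: le_lt_trans (ler_norm _) h.
Qed.

(** This takes the place of martingale convergence. Inner regularity gives a compact [V] inside [A]
    with [A \ V] small. On an interval meeting [V], [1 - dens A] is at most the density of the hull
    minus [V]; on any other interval [dens A] is at most the density of [A \ V]. *)
Lemma dens_min_small {R : realType} (A : set R) (e : R) :
  measurable A -> A `<=` unitI -> 0 < e ->
  exists n, (\sum_(k < 2 ^ n) Num.min (dens A n k) (1 - dens A n k)) / 2 ^+ n < e.
Proof.
move=> mA AI e0; have e2 : 0 < e / 2 by rewrite divr_gt0.
have Afin : (lebesgue_measure A < +oo)%E.
  by rewrite -(setIidl AI) -dyint0 lebesgue_measure_setI_dyint// ltry.
have [V [cV VA AV]] := lebesgue_regularity_inner mA Afin e2.
have clV : closed V by apply: compact_closed => //; exact: Rhausdorff.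
have mV : measurable V by exact: closed_measurable.
have mAV : measurable (A `\` V) by exact: measurableD.
have [n hn] := measure_dyadic_hull_small clV e2; exists n.
have mGV : measurable (dyadic_hull n V `\` V).
  by apply: measurableD => //; exact: measurable_dyadic_hull.
have -> : e = e / 2 + e / 2 by field.
have AV' : dens (A `\` V) 0 0 < e / 2.
  rewrite dens00; last by move=> y [/AI].
  by rewrite -lte_fin fineK// ge0_fin_numE//; apply: lt_trans AV _; exact: ltry.
apply: le_lt_trans (ltrD AV' hn).
(* The two total measures become averages over generation [n], which allows a comparison interval by
   interval. *)
rewrite -(dens_avg n mAV) -(dens_avg n mGV) -mulrDl -big_split /=.
rewrite ler_pM2r ?invr_gt0 ?exprn_gt0//; apply: ler_sum => k _.
have [kV|kV] := pselect (dyint n k `&` V !=set0).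
  rewrite ge_min; apply/orP; right; rewrite -[leLHS]add0r lerD ?dens_ge0//.
  apply: (@le_trans _ _ (dens (~` V) n k)).
    rewrite densC// lerD2l lerN2; apply: dens_le => // y [/VA Ay _].
    exact: Ay.
  apply: dens_le => //; first exact: measurableC.
  by move=> y [nVy ky]; split => //; exists k.
rewrite ge_min; apply/orP; left; rewrite -[leLHS]addr0 lerD ?dens_ge0//.
apply: dens_le => // y [Ay ky]; split => // Vy.
by apply: kV; exists y.
Qed.

Lemma F11_le_norm1 {R : realType} (f : R -> R) (A : set R) : F11 f ->
  measurable A -> A `<=` unitI ->
  ((f (fine (lebesgue_measure A)))%:E <= norm1 (S1 (\1_A : R -> R)))%E.
Proof.
move=> Ff mA AI; apply/lee_addgt0Pr => e e0.
have e2 : 0 < e / 2 by rewrite divr_gt0.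
have [C C0 fC] := F11_bound Ff e2.
(* Half of [e] is spent on the additive error of [F11_bound], the other half on [C] times the mean
   of the minimum. *)
have eC : 0 < e / 2 / C by rewrite divr_gt0.
have [n hn] := dens_min_small mA AI eC.
apply: (@le_trans _ _ ((\sum_(i < n) dvar A i)%:E + e%:E)%E); last first.
  by rewrite leeD2r//; move: n {hn}; apply/norm1_S1_le.
rewrite -EFinD lee_fin -dens00//; apply: le_trans (F11_le_dvar n Ff mA) _.
rewrite addrC lerD2l.
apply: (@le_trans _ _ (e / 2 + C * (e / 2 / C))); last first.
  by rewrite le_eqVlt; apply/orP; left; apply/eqP; field; rewrite gt_eqF.
apply: (@le_trans _ _ (e / 2 + C * ((\sum_(k < 2 ^ n) Num.min (dens A n k) (1 - dens A n k)) / 2 ^+ n))); last first.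
  by rewrite lerD2l ler_pM2l// ltW.
rewrite mulrA ler_pdivrMr ?exprn_gt0// mulrDl divfK ?expf_neq0//.
rewrite mulr_sumr; have -> : e / 2 * 2 ^+ n = \sum_(k < 2 ^ n) (e / 2).
  by rewrite sumr_const card_ord -[RHS]mulr_natr natrX.
rewrite -big_split /=; apply: ler_sum => k _; apply: fC.
by rewrite in_itv /= dens_ge0 dens_le1.
Qed.

(** * Continuity of bounded functions with the midpoint inequality *)

(* Write [u] as the midpoint of [v] and [z = 2u - v], and apply the induction
   hypothesis to [z] and [v]; if [z] leaves [0, 1], use instead [u] as the midpoint
   of an endpoint, where [f] vanishes, and of the point [2u] or [2u - 1]. *)
Lemma approx_midconvex_modulus {R : realType} (f : R -> R) :
  (forall x, x \in `[0, 1] -> 0 <= f x <= 1) -> f 0 = 0 -> f 1 = 0 ->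
  (forall x y, x \in `[0, 1] -> y \in `[0, 1] ->
    f ((x + y) / 2) <= (f x + f y) / 2 + `|(x - y) / 2|) ->
  forall k u v, u \in `[0, 1] -> v \in `[0, 1] -> `|u - v| <= (2 ^+ k)^-1 ->
    f u - f v <= 2 * (3 / 4) ^+ k.
Proof.
move=> f01 f0 f1 hf; elim=> [|k IH] u v uI vI uv.
  by have := f01 _ uI; have := f01 _ vI; rewrite expr0; lra.
have k2 : (2 ^+ k.+1)^-1 = (2 ^+ k)^-1 / 2 :> R by rewrite exprSr invfM.
(* The rate 3/4 closes the induction: half the previous bound is [(3/4)^k], the midpoint error is at
   most [2^-k / 2 <= (3/4)^k / 2], and the sum is exactly [2 * (3/4)^(k+1)]. *)
have q : (2 ^+ k)^-1 <= (3 / 4) ^+ k :> R.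
  by rewrite -exprVn lerXn2r ?nnegrE//; lra.
have hfuv := f01 _ vI.
have I0 : (0 : R) \in `[0, 1] by rewrite in_itv /=; lra.
have I1 : (1 : R) \in `[0, 1] by rewrite in_itv /=; lra.
have := uI; have := vI; rewrite !in_itv /= => /andP[v0 v1] /andP[u0 u1].
move: uv; rewrite k2 ler_norml => /andP[uv1 uv2].
rewrite exprS; have [z0|z0] := ltP (2 * u - v) 0.
  have wI : 2 * u \in `[0, 1] by rewrite in_itv /=; lra.
  have := IH _ _ wI vI; rewrite ler_norml => /(_ ltac:(lra)) h.
  have := hf _ _ I0 wI; rewrite f0 ler0_norm; last by lra.
  by rewrite (_ : (0 + 2 * u) / 2 = u); [lra|field].
have [z1|z1] := ltP 1 (2 * u - v).
  have wI : 2 * u - 1 \in `[0, 1] by rewrite in_itv /=; lra.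
  have := IH _ _ wI vI; rewrite ler_norml => /(_ ltac:(lra)) h.
  have := hf _ _ I1 wI; rewrite f1 ger0_norm; last by lra.
  by rewrite (_ : (1 + (2 * u - 1)) / 2 = u); [lra|field].
have zI : 2 * u - v \in `[0, 1] by rewrite in_itv /=; lra.
have := IH _ _ zI vI; rewrite ler_norml => /(_ ltac:(lra)) h.
have := hf _ _ vI zI; rewrite (_ : (v + (2 * u - v)) / 2 = u); last by field.
by have : `|(v - (2 * u - v)) / 2| <= (2 ^+ k)^-1 / 2; [rewrite ler_norml; lra|lra].
Qed.

(** Exchanging the two points in the one-sided estimate gives a uniform modulus, and
    [2 * (3 / 4) ^+ k] tends to 0. *)
Lemma approx_midconvex_continuous {R : realType} (f : R -> R) :
  (forall x, x \in `[0, 1] -> 0 <= f x <= 1) -> f 0 = 0 -> f 1 = 0 ->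
  (forall x y, x \in `[0, 1] -> y \in `[0, 1] ->
    f ((x + y) / 2) <= (f x + f y) / 2 + `|(x - y) / 2|) ->
  {within `[0, 1], continuous f}.
Proof.
move=> f01 f0 f1 hf; have hmod := approx_midconvex_modulus f01 f0 f1 hf.
apply/subspace_continuousP => x /= xI; apply/cvgrPdist_lt => e e0.
have [k hk] : exists k, 2 * (3 / 4) ^+ k < e.
  have q1 : `|3 / 4 : R| < 1 by rewrite ger0_norm; lra.
  have e2 : 0 < e / 2 by rewrite divr_gt0.
  have /cvgrPdist_lt/(_ _ e2)[k _ /(_ k)/=] := cvg_expr q1.
  rewrite leqnn => /(_ isT); rewrite sub0r normrN ger0_norm; last by rewrite exprn_ge0//; lra.
  by move=> h; exists k; lra.
have k0 : 0 < (2 ^+ k)^-1 :> R by rewrite invr_gt0 exprn_gt0.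
rewrite near_withinE; exists ((2 ^+ k)^-1) => //= y /ltW xy yI.
apply: le_lt_trans hk; rewrite ler_norml lerNl opprB.
by rewrite !hmod// distrC.
Qed.

(** * Placing two sets in the halves of the unit interval *)

Lemma measurable_half {R : realType} (c : R) (A : set R) : measurable A ->
  measurable ((fun y : R => 2 * y - c) @^-1` A).
Proof.
move=> mA; rewrite -[X in measurable X]setTI.
have : measurable_fun setT (fun y : R => 2 * y - c).
  by apply: measurable_funB => //; exact: measurable_funM.
exact.
Qed.

(** The image of twice Lebesgue measure under [y -> 2 * y - c] agrees with Lebesgue measure on
    half-open intervals, hence everywhere by uniqueness. *)
Lemma lebesgue_measure_half {R : realType} (c : R) (A : set R) : measurable A ->
  lebesgue_measure A =
  (2%:E * lebesgue_measure ((fun y : R => 2 * y - c)%R @^-1` A))%E.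
Proof.
move=> mA.
have mf : measurable_fun setT (fun y : R => 2 * y - c : measurableTypeR R).
  by apply: measurable_funB => //; exact: measurable_funM.
transitivity (pushforward (mscale (NngNum (ler0n R 2)) lebesgue_measure)
  (fun y : R => 2 * y - c : measurableTypeR R) A) => //.
apply: lebesgue_measure_unique => // _ [[a b]] _ <-.
pose J : set R := `](a + c) / 2, (b + c) / 2]%classic.
transitivity (2%:E * lebesgue_measure J)%E.
  rewrite !lebesgue_measure_itv /= !lte_fin ltr_pM2r// ltrD2r.
  case: ifPn => _; last by rewrite mule0.
  by rewrite -!EFinD -EFinM; congr EFin; field.
congr (_ * lebesgue_measure _)%E; apply/seteqP.
by split => y; rewrite /J /= !in_itv /= => /andP[h1 h2]; apply/andP; split; lra.
Qed.

(** The term [- 0] makes both halves instances of the same map [2 * y - c]. *)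
Definition concat {R : realType} (A B : set R) : set R :=
  (fun y : R => 2 * y - 0) @^-1` A `|` (fun y : R => 2 * y - 1) @^-1` B.

Lemma measurable_concat {R : realType} (A B : set R) :
  measurable A -> measurable B -> measurable (concat A B).
Proof. by move=> mA mB; apply: measurableU; exact: measurable_half. Qed.

Lemma concat_unitI {R : realType} (A B : set R) :
  A `<=` unitI -> B `<=` unitI -> concat A B `<=` unitI.
Proof.
by move=> AI BI y [/AI|/BI]; rewrite /unitI /= !in_itv /= => /andP[h1 h2];
  apply/andP; split; lra.
Qed.

Lemma dens_concatl {R : realType} (A B : set R) n k : measurable A ->
  measurable B -> B `<=` unitI -> (k < 2 ^ n)%N -> dens (concat A B) n.+1 k = dens A n k.
Proof.
move=> mA mB BI kn; rewrite /dens (lebesgue_measure_half 0 (A := A `&` _)); last exact: measurableI.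
have -> : (fun y : R => 2 * y - 0) @^-1` (A `&` dyint n k) = concat A B `&` dyint n.+1 k.
  apply/seteqP; split => y.
    move=> /= [Ay /dyintP ky]; split; first by left.
    by apply/dyintP; move: ky; rewrite subr0 exprSr mulrA.
  move=> [Cy ky]; have ky' : dyint n k (2 * y - 0).
    by move/dyintP: ky => ky; apply/dyintP; rewrite subr0 mulrA -exprSr.
  split => //; case: Cy => // /BI; have := dyint_sub_unitI kn ky'.
  by rewrite /unitI /= !in_itv /=; lra.
rewrite fineM//; last by apply: fin_num_setI_dyint; exact: measurable_concat.
by rewrite exprSr -mulrA.
Qed.

Lemma dens_concatr {R : realType} (A B : set R) n k : measurable A ->
  measurable B -> A `<=` unitI ->
  dens (concat A B) n.+1 (2 ^ n + k) = dens B n k.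
Proof.
move=> mA mB AI; rewrite /dens (lebesgue_measure_half 1 (A := B `&` _)); last exact: measurableI.
have -> : (fun y : R => 2 * y - 1) @^-1` (B `&` dyint n k) =
    concat A B `&` dyint n.+1 (2 ^ n + k).
  have e y : dyint n k (2 * y - 1) <-> dyint n.+1 (2 ^ n + k) y.
    rewrite !dyintP -addnS !natrD natrX mulrBr mulr1 mulrA -exprSr.
    by rewrite lerBrDl ltrBlDl.
  apply/seteqP; split => y; first by move=> [By /e ky]; split => //; right.
  move=> [Cy /e ky]; split => //; case: Cy => // /AI; move/dyintP: ky => /andP[h _].
  rewrite /unitI /= !in_itv /= => /andP[_ h2].
  have : 0 <= 2 ^+ n * (2 * y - 1) by apply: le_trans h.
  by rewrite pmulr_rge0 ?exprn_gt0//; lra.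
rewrite fineM//; last by apply: fin_num_setI_dyint; exact: measurable_concat.
by rewrite exprSr -mulrA.
Qed.

Lemma dens_concat00 {R : realType} (A B : set R) : measurable A -> measurable B ->
  A `<=` unitI -> B `<=` unitI ->
  dens (concat A B) 0 0 = (dens A 0 0 + dens B 0 0) / 2.
Proof.
move=> mA mB AI BI; rewrite dens_split; last exact: measurable_concat.
by rewrite dens_concatl// (@dens_concatr _ A B 0 0).
Qed.

Lemma dvar_concat0 {R : realType} (A B : set R) : measurable A -> measurable B ->
  A `<=` unitI -> B `<=` unitI ->
  dvar (concat A B) 0 = `|dens A 0 0 - dens B 0 0| / 2.
Proof.
move=> mA mB AI BI; rewrite dvarE; last exact: measurable_concat.
by rewrite expn0 big_ord1 dens_concatl// (@dens_concatr _ A B 0 0)// expr1.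
Qed.

Lemma dvar_concatS {R : realType} (A B : set R) n : measurable A -> measurable B ->
  A `<=` unitI -> B `<=` unitI ->
  dvar (concat A B) n.+1 = (dvar A n + dvar B n) / 2.
Proof.
move=> mA mB AI BI; rewrite !dvarE//; last exact: measurable_concat.
rewrite -mulrDl exprSr invfM mulrA; congr (_ / _ / _).
(* The first [2 ^ n] parents lie in the left half and carry the densities of [A]; the others lie in
   the right half and carry those of [B]. *)
rewrite expnS mul2n -addnn big_split_ord /=; congr (_ + _); apply: eq_bigr => k _.
  have := ltn_ord k => kn.
  by rewrite !dens_concatl//; rewrite expnS; lia.
rewrite doubleD -mul2n -expnS -addnS !dens_concatr//.
Qed.

(** * The least variation among sets of given measure *)

(** Here [a] is any real upper bound of the norm, not the norm itself, so the infimum below is taken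
    in [R] and sets of infinite norm drop out. *)
Definition achievable {R : realType} (x a : R) :=
  exists A : set R, [/\ measurable A, A `<=` unitI, dens A 0 0 = x &
    forall N, \sum_(n < N) dvar A n <= a].

Lemma achievable_ge0 {R : realType} (x a : R) : achievable x a -> 0 <= a.
Proof. by move=> [A [_ _ _ /(_ 0%N)]]; rewrite big_ord0. Qed.

Lemma achievable_midpoint {R : realType} (x y a b : R) :
  achievable x a -> achievable y b ->
  achievable ((x + y) / 2) ((a + b) / 2 + `|(x - y) / 2|).
Proof.
move=> [A [mA AI <- ha]] [B [mB BI <- hb]]; exists (concat A B); split.
- exact: measurable_concat.
- exact: concat_unitI.
- exact: dens_concat00.
- move=> [|N].
    rewrite big_ord0; have := ha 0%N; have := hb 0%N; rewrite !big_ord0 => a0 b0.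
    by rewrite addr_ge0// divr_ge0// addr_ge0.
  rewrite big_ord_recl dvar_concat0// addrC normrM [`|2^-1|]ger0_norm// lerD2r.
  under eq_bigr do rewrite dvar_concatS//.
  by rewrite -mulr_suml big_split /= ler_pM2r//; apply: lerD; [exact: ha|exact: hb].
Qed.

(* The witness is [0, x[. Its densities decrease from left to right, so the sum
   defining [dvar] telescopes to at most one interval's worth. *)
Lemma achievable_initial {R : realType} (x : R) : x \in `[0, 1] -> achievable x 1.
Proof.
rewrite in_itv /= => /andP[x0 x1]; pose A : set R := `[0, x[%classic.
have mA : measurable A by exact: measurable_itv.
have AI : A `<=` unitI.
  by move=> y; rewrite /A /unitI /= !in_itv /= => /andP[-> yx]; exact: lt_le_trans yx x1.
(* The density is [2^n x - k] clamped to [0, 1], which turns monotonicity in [k] into a case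
   analysis. *)
have hA n k : dens A n k = Num.max 0 (Num.min (2 ^+ n * x - k%:R) 1).
  have p : 0 < 2 ^+ n :> R by rewrite exprn_gt0.
  rewrite /dens (_ : A `&` _ = `[k%:R / 2 ^+ n, Num.min x (k.+1%:R / 2 ^+ n)[%classic).
    rewrite lebesgue_measure_itv /= lte_fin lt_min [X in _ && X]ltr_pM2r ?invr_gt0//.
    rewrite ltr_nat leqnn andbT ltr_pdivrMr// [x * _]mulrC.
    case: ifPn => [h|]; last first.
      rewrite -leNgt => h; rewrite /= mulr0; apply/esym/max_l.
      by rewrite ge_min subr_le0 h.
    rewrite -EFinD /= mulrBr minr_pMr ?ltW// !(mulrCA (2 ^+ n)) !divff ?gt_eqF// !mulr1.
    rewrite [RHS]max_r; last by rewrite le_min ler01 subr_ge0 ltW.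
    by rewrite -natr1 /Num.min; do 2![case: ifP]; lra.
  apply/seteqP; split => y; rewrite /A /dyint /= !in_itv /= lt_min.
    by move=> [/andP[_ ->] /andP[-> ->]].
  move=> /andP[h /andP[-> ->]]; rewrite h; split => //; rewrite andbT.
  by apply: le_trans h; rewrite divr_ge0// ltW.
have hdec n k : dens A n k.+1 <= dens A n k.
  rewrite !hA -natr1 /Num.max /Num.min; set t := 2 ^+ n * x; set m := k%:R.
  by do ![case: ifP]; lra.
have htel n m : \sum_(k < m) `|dens A n k.*2 - dens A n k.*2.+1| <=
    dens A n 0 - dens A n m.*2.
  elim: m => [|m IH]; first by rewrite big_ord0 subrr.
  rewrite big_ord_recr /= doubleS ger0_norm ?subr_ge0//.
  by have := hdec n m.*2.+1; lra.
have hdvar n : dvar A n <= (2 ^+ n.+1)^-1.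
  rewrite dvarE// ler_piMl ?invr_ge0 ?exprn_ge0//; apply: le_trans (htel _ _) _.
  by rewrite lerBlDr (le_trans (dens_le1 _ _ mA))// lerDl dens_ge0.
exists A; split => //.
  by rewrite hA expr0 mul1r subr0 min_l// max_r.
(* The claim is strengthened to the exact geometric partial sum so that the induction on [N]
   closes. *)
move=> N; apply: (@le_trans _ _ (1 - (2 ^+ N)^-1)); last by rewrite gerBl invr_ge0 exprn_ge0.
elim: N => [|N IH]; first by rewrite big_ord0 expr0 invr1 subrr.
rewrite big_ord_recr /=; have := hdvar N; rewrite exprSr invfM; lra.
Qed.

Lemma achievable0 {R : realType} : achievable (0 : R) 0.
Proof.
have d0 n k : dens (set0 : set R) n k = 0 by rewrite /dens set0I measure0 mulr0.
exists set0; split => // N; rewrite big1// => n _.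
by rewrite dvarE// big1 ?mul0r// => k _; rewrite !d0 subrr normr0.
Qed.

Lemma achievable1 {R : realType} : achievable (1 : R) 0.
Proof.
have d1 n k : (k < 2 ^ n)%N -> dens (unitI : set R) n k = 1.
  move=> kn; rewrite /dens (setIidr (dyint_sub_unitI kn)) lebesgue_measure_dyint.
  by rewrite /= divff// expf_neq0.
exists unitI; split => //; first exact: d1.
move=> N; rewrite big1// => n _; rewrite dvarE// big1 ?mul0r// => k _.
have kn := ltn_ord k.
by rewrite !d1 ?subrr ?normr0//; rewrite expnS; lia.
Qed.

Definition least_variation {R : realType} (x : R) : R := inf [set a | achievable x a].

Lemma least_variation_le {R : realType} (x a : R) :
  achievable x a -> least_variation x <= a.
Proof. by move=> xa; apply: ge_inf => //; exists 0 => b; exact: achievable_ge0. Qed.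

Lemma has_inf_achievable {R : realType} (x : R) : x \in `[0, 1] ->
  has_inf [set a | achievable x a].
Proof.
move=> xI; split; first by exists 1; exact: achievable_initial.
by exists 0 => b; exact: achievable_ge0.
Qed.

Lemma least_variation_ge0 {R : realType} (x : R) : x \in `[0, 1] ->
  0 <= least_variation x.
Proof.
by move=> /has_inf_achievable[h _]; apply: lb_le_inf => // b; exact: achievable_ge0.
Qed.

(** The midpoint inequality passes from near-optimal pairs to the infimum with error [e]; continuity
    then follows from it, the zero endpoint values and the bound 1. *)
Lemma F11_least_variation {R : realType} : F11 (@least_variation R).
Proof.
have W0 : least_variation (0 : R) = 0.
  apply/eqP; rewrite eq_le least_variation_le; last exact: achievable0.
  by apply: least_variation_ge0; rewrite in_itv /= lexx ler01.
have W1 : least_variation (1 : R) = 0.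
  apply/eqP; rewrite eq_le least_variation_le; last exact: achievable1.
  by apply: least_variation_ge0; rewrite in_itv /= lexx ler01.
have Wmid (x y : R) : x \in `[0, 1] -> y \in `[0, 1] ->
    least_variation ((x + y) / 2) <=
    (least_variation x + least_variation y) / 2 + `|(x - y) / 2|.
  move=> xI yI; apply/ler_addgt0Pr => e e0.
  have [a xa ha] := inf_adherent e0 (has_inf_achievable xI).
  have [b yb hb] := inf_adherent e0 (has_inf_achievable yI).
  have := least_variation_le (achievable_midpoint xa yb).
  by move: ha hb; rewrite -/(least_variation x) -/(least_variation y); lra.
split => //; last exact: least_variation_ge0.
apply: approx_midconvex_continuous => // x xI.
by rewrite least_variation_ge0// least_variation_le//; exact: achievable_initial.
Qed.

Theorem theorem1p8 (R : realType) (x : R) (hx : 0 <= x <= 1) :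
  ereal_inf [set norm1 (S1 (\1_A : R -> R)) | A in
    [set A : set R | [/\ measurable A, A `<=` unitI & lebesgue_measure A = x%:E]]] = B11 x.
Proof.
have xI : x \in `[0, 1] by rewrite in_itv.
apply/eqP; rewrite eq_le; apply/andP; split.
  (* [least_variation] is itself a competitor in the supremum, and sets nearly attaining it bound
     the infimum of norms from above. *)
  apply: (@le_trans _ _ (least_variation x)%:E); last first.
    by apply: ereal_sup_ubound; exists (@least_variation R) => //; exact: F11_least_variation.
  apply/lee_addgt0Pr => e e0.
  have [a [A [mA AI Ax ha]] hxa] := inf_adherent e0 (has_inf_achievable xI).
  apply: (@le_trans _ _ a%:E); last by rewrite -EFinD lee_fin ltW.
  apply: ge_ereal_inf; exists (norm1 (S1 (\1_A : R -> R))).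
    exists A => //; split => //; rewrite -Ax dens00// fineK//.
    by rewrite -(setIidl AI) -dyint0 fin_num_setI_dyint.
  by apply/norm1_S1_le => // N; rewrite lee_fin; exact: ha.
(* For the other inequality each competitor [f] is compared with each set [A]. *)
apply/ereal_infP => _ [A [mA AI Ax] <-]; apply/ereal_supP => _ [f Ff <-].
by have := F11_le_norm1 Ff mA AI; rewrite Ax.
Qed.
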